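(* Let $\mathrm{H}$ be a finite group and $\sigma\in\mathrm{Aut}(\mathrm{H})$ with $\sigma^2=\mathrm{Id}$. Then there exists a Sylow $2$-subgroup $P_2\le\mathrm{H}$ with $\sigma(P_2)=P_2$ such that $\mathcal{G}_{\mathrm{TF}}(\mathrm{H},\sigma)\le\mathcal{G}_{\mathrm{TF}}(P_2,\sigma|_{P_2})$.
   Context: For a finite group $K$ and $\tau\in\mathrm{Aut}(K)$ with $\tau^2=\mathrm{Id}$: $\mathbb{Z}_2=\{e,x\}$, $K\rtimes_\theta\mathbb{Z}_2$ is the semidirect product with $\theta(x)=\tau$ (so $xkx=\tau(k)$), $K$ is identified with $K\times\{e\}$, $S(K,\tau)$ is the set of $g\in K\rtimes_\theta\mathbb{Z}_2$ with $g\notin K$ and $g^2=e$, and $\mathcal{G}_{\mathrm{TF}}(K,\tau)$ is the number of conjugacy classes of $K\rtimes_\theta\mathbb{Z}_2$ contained in $S(K,\tau)$. *)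

(* Defs.v *)
From mathcomp Require Import all_boot zmodp.
From mathcomp Require Import all_fingroup all_solvable.

Set Implicit Arguments.
Unset Strict Implicit.
Unset Printing Implicit Defensive.

Local Open Scope group_scope.

(* Elements of [Aut K] are permutations of the ambient type that fix every    *)
(* point outside K, so each automorphism of K occurs exactly once.            *)
Section Twisted.

Variables (gT : finGroupType) (K : {group gT}) (tau : {perm gT}).
Hypotheses (tauA : tau \in Aut K) (tau2 : tau ^+ 2 = 1).

Lemma Z2act_is_action :
  is_action [set: 'Z_2] (fun (k : gT) (i : 'Z_2) => (tau ^+ i) k).
Proof.
split=> [i k l /= | k i j _ _ /=]; first exact: perm_inj.
by rewrite -permM -expgD (expg_mod _ tau2).
Qed.

Definition Z2act := Action Z2act_is_action.

Lemma Z2act_is_groupAction : is_groupAction K Z2act.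
Proof.
move=> i _; rewrite /=; suff ->: actperm Z2act i = tau ^+ i by rewrite groupX.
by apply/permP=> k; rewrite actpermE.
Qed.

Definition Z2gact := GroupAction Z2act_is_groupAction.

(* The additive group 'Z_2 = {0, 1} plays the role of {e, x}.                 *)
Local Notation sdZ2 := (sdprod_by Z2gact).

Lemma sdZ2_conj (k : gT) : k \in K ->
  sdpair2 Z2gact Zp1 * sdpair1 Z2gact k * sdpair2 Z2gact Zp1 =
    sdpair1 Z2gact (tau k).
Proof.
move=> Kk; rewrite -[tau k]/(Z2gact k Zp1) sdpair_act ?inE //.
rewrite conjgE -morphV ?inE // mulgA.
by congr (sdpair2 _ _ * _ * _); apply/val_inj.
Qed.

Definition base_group : {set sdZ2} := sdpair1 Z2gact @* K.

Definition twisted_involutions : {set sdZ2} :=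
  [set g : sdZ2 | (g \notin base_group) && (g ^+ 2 == 1)].

Definition G_TF : nat :=
  #|[set C in classes [set: sdZ2] | C \subset twisted_involutions]|.

End Twisted.

Lemma restr_perm_involutive (gT : finGroupType) (P : {group gT})
    (sigma : {perm gT}) (sigma2 : sigma ^+ 2 = 1) :
  restr_perm P sigma ^+ 2 = 1.
Proof.
have [nP | nP] := boolP (sigma \in 'N(P | 'P)).
  by rewrite -morphX // sigma2 morph1.
by rewrite triv_restr_perm // expg1n.
Qed.

Arguments restr_perm_involutive {gT} P sigma sigma2.
Arguments G_TF {gT} K tau tauA tau2.

(* Main.v *)
(** Put G = H ><| Z_2, generated by H and an involution x inducing sigma.
    Choose a Sylow 2-subgroup S of G containing x. Then P_2 = H :&: S is Sylow
    in H, is normalised by x, and S = P_2 <x> is a copy of P_2 ><| Z_2. By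
    Sylow's theorem every involution of G outside H is conjugate into S, so
    mapping S-classes to the G-classes containing them is onto the classes of
    twisted involutions of G. *)
Require Import Defs.
From mathcomp Require Import all_boot zmodp.
From mathcomp Require Import all_fingroup all_solvable.

Local Open Scope group_scope.

Section TwistedInvolutions.

Variables (gT : finGroupType) (K : {group gT}) (tau : {perm gT}).
Hypotheses (tauA : tau \in Aut K) (tau2 : tau ^+ 2 = 1).

Let to := Z2gact tauA tau2.
Let base := sdpair1 to @* K.

Lemma base_normal : base <| [set: sdprod_by to].
Proof. by have /sdprod_context[] := sdprod_sdpair to. Qed.

(** Normality of the base keeps conjugates outside it, and conjugation commutes with squaring. Hence
    [G_TF] counts a class as soon as it has one twisted involution. *)
Lemma twisted_involutionsJ (g y : sdprod_by to) :
  (g ^ y \in twisted_involutions tauA tau2)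
    = (g \in twisted_involutions tauA tau2).
Proof.
have nby: y \in 'N(base) by apply: (subsetP (normal_norm base_normal)).
by rewrite !inE memJ_norm // -conjXg conjg_eq1.
Qed.

Lemma class_sub_twisted_involutions (g : sdprod_by to) :
  (g ^: [set: sdprod_by to] \subset twisted_involutions tauA tau2)
    = (g \in twisted_involutions tauA tau2).
Proof.
apply/idP/idP=> [/subsetP-> // | TIg]; first exact: class_refl.
by apply/subsetP=> _ /imsetP[y _ ->]; rewrite twisted_involutionsJ.
Qed.

End TwistedInvolutions.

(** Sending the class of [s] to that of [f s] is well defined, and by hypothesis its values cover
    every class counted for [L]. *)
Lemma G_TF_leq_morphism (gT rT : finGroupType) (K : {group gT})
    (L : {group rT}) (tau : {perm gT}) (rho : {perm rT})
    (tauA : tau \in Aut K) (tau2 : tau ^+ 2 = 1)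
    (rhoA : rho \in Aut L) (rho2 : rho ^+ 2 = 1)
    (f : {morphism [set: sdprod_by (Z2gact tauA tau2)]
           >-> sdprod_by (Z2gact rhoA rho2)}) :
    {in twisted_involutions rhoA rho2, forall g,
       exists2 s, s \in twisted_involutions tauA tau2 &
                  g \in f s ^: [set: sdprod_by (Z2gact rhoA rho2)]} ->
  G_TF L rho rhoA rho2 <= G_TF K tau tauA tau2.
Proof.
move=> f_onto; rewrite /G_TF.
set A := [set C in _ | _]; set B := [set C in _ | _].
pose F (C : {set sdprod_by (Z2gact tauA tau2)}) :=
  f (repr C) ^: [set: sdprod_by (Z2gact rhoA rho2)].
apply: leq_trans (leq_imset_card F B); apply/subset_leq_card/subsetP=> C.
rewrite inE => /andP[/imsetP[g _ ->]]; rewrite class_sub_twisted_involutions.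
case/f_onto=> s TIs /class_eqP->; apply/imsetP.
exists (s ^: [set: sdprod_by (Z2gact tauA tau2)]).
  by rewrite inE mem_classes ?inE //= class_sub_twisted_involutions.
(* The representative is some [s ^ y], whose image is conjugate to [f s], so the choice made in [F]
   is harmless. *)
rewrite /F; have [y _ ->] := repr_class [set: sdprod_by (Z2gact tauA tau2)] s.
by rewrite morphJ ?inE // classGidl ?inE.
Qed.

Section InvariantSubgroup.

Variables (gT : finGroupType) (K P : {group gT}) (tau : {perm gT}).
Hypotheses (tauA : tau \in Aut K) (tau2 : tau ^+ 2 = 1).
Hypotheses (sPK : P \subset K) (nPtau : tau \in 'N(P | 'P)).

Let to := Z2gact tauA tau2.
Let toP := Z2gact (Aut_restr_perm sPK tauA) (restr_perm_involutive P tau tau2).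

(** Compatibility that lets the embeddings of [P] and of the complement glue to one morphism on the
    semidirect product. *)
Lemma sdZ2_incl_act :
  {in P & [set: 'Z_2],
     morph_act toP 'J (restrm sPK (sdpair1 to)) (sdpair2 to)}.
Proof.
move=> k i Pk Zi; rewrite /= /restrm -sdpair_act ?(subsetP sPK) //=.
by rewrite -morphX // restr_permE ?groupX.
Qed.

Definition sdZ2_incl : sdprod_by toP -> sdprod_by to :=
  xsdprodm sdZ2_incl_act.

Canonical sdZ2_incl_morphism := [morphism of sdZ2_incl].

(** Both glued maps are injective, and the image of [P] lies in that of [K], which meets the
    complement trivially. *)
Lemma injm_sdZ2_incl : 'injm sdZ2_incl.
Proof.
rewrite injm_xsdprodm injm_restrm ?injm_sdpair1 ?injm_sdpair2 //=.
rewrite -subG1 -(im_sdpair_TI to) setSI //= morphim_restrm setIid.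
exact: morphimS.
Qed.

Lemma sdZ2_incl1 (k : gT) : k \in P ->
  sdZ2_incl (sdpair1 toP k) = sdpair1 to k.
Proof.
move=> Pk; rewrite /sdZ2_incl /xsdprodm sdprodmEl ?mem_morphim //.
by congr sdpair1; apply: invmE.
Qed.

Lemma im_sdZ2_incl :
  sdZ2_incl @* setT = (sdpair1 to @* P) * (sdpair2 to @* setT).
Proof. by rewrite im_xsdprodm morphim_restrm setIid. Qed.

(** Injectivity reflects [s ^+ 2 = 1]; an [s] in the base over [P] would land in the base over
    [K]. *)
Lemma sdZ2_incl_twisted (s : sdprod_by toP) :
    sdZ2_incl s \in twisted_involutions tauA tau2 ->
  s \in twisted_involutions (Aut_restr_perm sPK tauA)
          (restr_perm_involutive P tau tau2).
Proof.
rewrite !inE -morphX ?inE // morph_injm_eq1 ?injm_sdZ2_incl ?inE //.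
case/andP=> nKs ->; rewrite andbT; apply: contra nKs.
case/morphimP=> k _ Pk ->; rewrite -/toP sdZ2_incl1 //.
by rewrite mem_morphim ?(subsetP sPK).
Qed.

End InvariantSubgroup.

Theorem theorem10p1 (gT : finGroupType) (H : {group gT}) (sigma : {perm gT})
    (sigmaA : sigma \in Aut H) (sigma2 : sigma ^+ 2 = 1) :
  exists (P2 : {group gT}) (sylP2 : 2.-Sylow(H) P2),
    sigma @: P2 = P2 /\
    (G_TF H sigma sigmaA sigma2
       <= G_TF P2 (restr_perm P2 sigma)
            (Aut_restr_perm (pHall_sub sylP2) sigmaA)
            (restr_perm_involutive P2 sigma sigma2))%N.
Proof.
pose to := Z2gact sigmaA sigma2.
pose X := (sdpair2 to @* setT)%G; pose B := (sdpair1 to @* H)%G.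
have p_X: 2.-group X by rewrite morphim_pgroup // /pgroup cardsT card_ord.
have [S sylS sXS] := Sylow_superset (subsetT X) p_X.
pose P := (sdpair1 to @*^-1 S)%G.
have sPH: P \subset H by apply: subsetIl.
have imP: sdpair1 to @* P = B :&: S by rewrite /= -morphim_setIpre (setIidPr sPH).
have sylP: 2.-Sylow(H) P.
  rewrite -(injm_pHall (injm_sdpair1 to)) // imP.
  exact: (Sylow_setI_normal (base_normal gT H sigma sigmaA sigma2) sylS).
have nPsigma: sigma \in 'N(P | 'P).
  rewrite inE ?inE /=; apply/subsetP=> k Pk; rewrite inE /= /aperm.
  have [Hk Sk] := morphpreP Pk.
  rewrite mem_morphpre ?Aut_closed //.
  (* In the semidirect product [sigma k] is the conjugate of [k] by the involution of [X], which
     lies in [S]. *)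
  rewrite /= -[sigma k]/(to k Zp1) sdpair_act ?inE // groupJ //.
  by apply: (subsetP sXS); rewrite mem_morphim ?inE.
exists P, sylP; split; first exact: (astabs_setact nPsigma).
pose f := sdZ2_incl_morphism gT H P sigma sigmaA sigma2
  (pHall_sub sylP) nPsigma.
apply: (G_TF_leq_morphism _ _ _ _ _ _ _ _ _ _ f) => g TIg.
have p_g: 2.-group <[g]>.
  move: TIg; rewrite inE -order_dvdn => /andP[_ /pnat_dvd]; exact.
have [y _ sgS] := Sylow_Jsub sylS (subsetT _) p_g.
have: g ^ y \in f @* setT.
  (* Dedekind's modular law: since [X] lies in [S], [(S :&: B) * X = S :&: B * X], and [B * X] is
     the whole group, so [f] has image [S]. *)
  rewrite im_sdZ2_incl imP setIC group_modr // im_sdpair setIT.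
  by rewrite -cycle_subG cycleJ.
case/morphimP=> s _ _ def_gy; exists s.
  by apply: sdZ2_incl_twisted; rewrite -def_gy twisted_involutionsJ.
by rewrite /= -def_gy class_sym memJ_class ?inE.
Qed.
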